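(* For every integer $k\ge2$, $\hat\lambda_k\in[1/\kappa,\,r_k]$, where $\kappa=k(k+1)/2$.
   Context: For an integer $k\ge1$ and a real $\lambda>0$, the Poisson distribution of order $k$ with parameter $\lambda$ is the distribution on $\{0,1,2,\dots\}$ with probability mass function $f_k(n;\lambda)=e^{-k\lambda}h_k(n;\lambda)$, where $$h_k(n;\lambda)=\sum_{n_1+2n_2+\dots+kn_k=n}\frac{\lambda^{n_1+\dots+n_k}}{n_1!\cdots n_k!},\qquad n=0,1,2,\dots,$$ the sum being over all tuples $(n_1,\dots,n_k)$ of nonnegative integers with $n_1+2n_2+\dots+kn_k=n$ (so $h_k(0;\lambda)=1$). A mode is a location of a global maximum of $n\mapsto f_k(n;\lambda)$ over $n\ge0$; modes need not be unique. For $k\ge2$, $\hat\lambda_k$ denotes the smallest value of $\lambda>0$ for which $0$ and some integer $m>0$ are both modes of the Poisson distribution of order $k$ with parameter $\lambda$ (the first double mode; the possibility of further modes at $\lambda=\hat\lambda_k$ is not excluded by the definition). For $k\ge2$, $r_k$ denotes the unique positive root $\lambda$ of the equation $h_k(k;\lambda)=1$; it lies in $(0,1)$. *)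

(* Defs.v *)
From HB Require Import structures.
From mathcomp Require Import all_boot all_order all_algebra.
From mathcomp Require Import all_classical all_reals all_analysis.

Set Implicit Arguments.
Unset Strict Implicit.
Unset Printing Implicit Defensive.

Import Order.TTheory GRing.Theory Num.Theory.

Local Open Scope classical_set_scope.
Local Open Scope ring_scope.

Section PoissonOrderK.
Variable R : realType.
Implicit Types (k m n : nat) (l : R).

(* The n_j of the formula for h_k (1 <= j <= k) is [t i] with j = i.+1.  Any
   tuple of naturals with \sum_j j * n_j = n has all its entries <= n, so
   letting the entries range over 'I_n.+1 loses no term of the sum. *)
Definition poisson_order_h k n l : R :=
  \sum_(t : {ffun 'I_k -> 'I_n.+1} | (\sum_(i < k) i.+1 * t i == n)%N)
     l ^+ (\sum_(i < k) t i)%N / \prod_(i < k) ((t i)`!)%:R.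

Definition poisson_order_pmf k n l : R := expR (- (k%:R * l)) * poisson_order_h k n l.

Definition is_mode k l m : Prop :=
  forall n, poisson_order_pmf k n l <= poisson_order_pmf k m l.

Definition double_mode_at_0 k : set R :=
  [set l | 0 < l /\ exists m, [/\ (0 < m)%N, is_mode k l 0 & is_mode k l m]].

(* [xget 0 A] is an element of [A] if there is one, and 0 otherwise.  The set
   below has at most one element.  Since 0 is not a positive real, a positive
   lower bound on [hat_lambda k] forces the smallest element to exist. *)
Definition hat_lambda k : R :=
  xget 0 [set l | double_mode_at_0 k l /\ lbound (double_mode_at_0 k) l].

(* [unique P r] says that [r] is the one and only element satisfying [P]; the
   value is 0 if there is no such element. *)
Definition root_r k : R :=
  xget 0 [set r | unique (fun l : R => 0 < l /\ poisson_order_h k k l = 1) r].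

Definition kappa k : R := (k%:R * (k%:R + 1)) / 2%:R.

End PoissonOrderK.

Arguments poisson_order_h {R} k n l.
Arguments poisson_order_pmf {R} k n l.
Arguments is_mode {R} k l m.

(* Main.v *)
(* Write h_n for h_k(n; l).  Counting sum_j j n_j over the tuples of weight n
   gives n h_n = l sum_(1 <= j <= k) j h_(n-j).  By induction this yields
   h_n(1/kappa) <= 1 and h_n -> 0 uniformly for bounded l.  The point 0 is a
   mode iff h_n <= 1 for all n; the set A of such l >= 0 is closed, contains
   1/kappa and is bounded by r_k because h_k is increasing.  At c = sup A some
   h_m with m > 0 equals 1, since otherwise the uniform decay leaves finitely
   many strict inequalities, which persist slightly beyond c.  Strict
   monotonicity excludes a double mode below c, so c is the first one. *)

Require Import Defs.
From HB Require Import structures.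
From mathcomp Require Import all_boot all_order all_algebra.
From mathcomp Require Import zify ring.
From mathcomp Require Import all_classical all_reals all_analysis.

Import Order.TTheory GRing.Theory Num.Theory.
Import numFieldNormedType.Exports.

Local Open Scope ring_scope.

Set Implicit Arguments.
Unset Strict Implicit.

Section PoissonOrderH.
Variables (R : realType) (k : nat).
Implicit Types (n : nat) (l : R).

(** * The sums h_n and their recurrence *)

Lemma poisson_order_h_ge0 n l : 0 <= l -> 0 <= poisson_order_h k n l.
Proof.
move=> l0; apply: sumr_ge0 => t _; apply: divr_ge0; first exact: exprn_ge0.
by apply: prodr_ge0 => i _; exact: ler0n.
Qed.

Lemma poisson_order_h0 l : poisson_order_h k 0 l = 1.
Proof.
rewrite /poisson_order_h (big_pred1 [ffun=> ord0]) => [|t /=].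
  under eq_bigr do rewrite ffunE; rewrite big1 // expr0.
  by rewrite big1 ?divr1 // => i _; rewrite ffunE.
have -> : t = [ffun=> ord0] by apply/ffunP => i; rewrite ffunE [t i]ord1.
by rewrite eqxx; apply/eqP; rewrite big1 // => i _; rewrite ffunE muln0.
Qed.

(* Reindexing by the bijection t |-> t - e_j between the tuples of weight n
   with t_j > 0 and the tuples of weight n - (j+1). *)
Lemma poisson_order_h_moment n l (j : 'I_k) :
  \sum_(t : {ffun 'I_k -> 'I_n.+1} | (\sum_(i < k) i.+1 * t i == n)%N)
     (t j)%:R * (l ^+ (\sum_(i < k) t i)%N / \prod_(i < k) ((t i)`!)%:R)
  = if (j < n)%N then l * poisson_order_h k (n - j.+1) l else 0.
Proof.
have entry_le m q (t : {ffun 'I_k -> 'I_q}) (i : 'I_k) :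
    (\sum_(i < k) i.+1 * t i == m)%N -> (i.+1 * t i <= m)%N.
  by move=> /eqP <-; rewrite (bigD1 i) //= leq_addr.
case: ltnP => jn; last first.
  apply: big1 => t tn.
  suff -> : val (t j) = 0%N by rewrite mul0r.
  apply/eqP; rewrite -leqn0 leqNgt; apply/negP => tj.
  by have := entry_le _ _ _ j tn; rewrite leqNgt (leq_trans _ (leq_pmulr _ tj)).
rewrite (bigID (fun t : {ffun 'I_k -> 'I_n.+1} => (0 < t j)%N)) /=.
rewrite [X in _ + X]big1 ?addr0; last first.
  by move=> t /andP[_]; rewrite -eqn0Ngt => /eqP ->; rewrite mul0r.
pose up (s : {ffun 'I_k -> 'I_(n - j.+1).+1}) : {ffun 'I_k -> 'I_n.+1} :=
  [ffun i => inord (s i + (i == j))].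
pose dn (t : {ffun 'I_k -> 'I_n.+1}) : {ffun 'I_k -> 'I_(n - j.+1).+1} :=
  [ffun i => inord (t i - (i == j))].
have upE s i : up s i = (s i + (i == j))%N :> nat.
  rewrite ffunE inordK // ltnS; have := ltn_ord (s i); rewrite ltnS => si.
  by apply: leq_trans (leq_add si (leq_b1 _)) _; rewrite addn1 -subSn // subSS leq_subr.
have sum_up (s : {ffun 'I_k -> 'I_(n - j.+1).+1}) (F : 'I_k -> nat) :
    (\sum_(i < k) F i * up s i = \sum_(i < k) F i * s i + F j)%N.
  under eq_bigr do rewrite upE mulnDr.
  rewrite big_split /=; congr addn; rewrite (bigD1 j) //= eqxx muln1 big1 ?addn0 //.
  by move=> i /negbTE ->; rewrite muln0.
(* The side condition is [up (dn t) = t]. No [inord] truncates here: weight n and t_j > 0 force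
   every entry of t - e_j to be at most n - (j+1). *)
rewrite (reindex_onto up dn) /=; last first.
  move=> t /andP[tn tj]; apply/ffunP => i; apply/val_inj; rewrite /= upE ffunE.
  have ij : ((i == j) <= t i)%N by case: eqP => [->|].
  rewrite inordK ?subnK // ltnS.
  have := tn; rewrite (bigD1 j) //= => /eqP tnj.
  case: (eqVneq i j) => [->|ij'].
    by rewrite leq_subLR; move: tnj; move: (t j : nat) tj => [//|a] _; nia.
  rewrite subn0; move: tnj; rewrite (bigD1 i) //=; nia.
rewrite /poisson_order_h mulr_sumr; apply: eq_big => [s|s /andP[/andP[sn sj] _]].
  rewrite sum_up upE eqxx addn1 andbT -[in RHS](eqn_add2r j.+1) subnK //.
  rewrite andb_idr // => _; apply/eqP/ffunP => i; apply/val_inj.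
  by rewrite /= ffunE upE addnK inordK.
have -> : (\sum_(i < k) up s i = (\sum_(i < k) s i).+1)%N.
  have := sum_up s (fun=> 1%N); under eq_bigr do rewrite mul1n.
  by under [in RHS]eq_bigr do rewrite mul1n; rewrite addn1.
rewrite exprS !(bigD1 (P:=predT) j) //=.
have -> : \prod_(i < k | i != j) ((up s i)`!)%:R =
    \prod_(i < k | i != j) ((s i)`!)%:R :> R.
  by apply: eq_bigr => i /negbTE ij; rewrite upE ij addn0.
(* The factor t_j = s_j + 1 cancels against (s_j + 1)! and leaves s_j!. *)
rewrite upE eqxx addn1 factS natrM.
have f0 m : m`!%:R != 0 :> R by rewrite pnatr_eq0 -lt0n fact_gt0.
have p0 : \prod_(i < k | i != j) ((s i)`!)%:R != 0 :> R by apply/prodf_neq0.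
have s0 : (s j).+1%:R != 0 :> R by rewrite pnatr_eq0.
by field; rewrite p0 f0 ?natr1 ?nat1r s0.
Qed.

(** Weight each tuple by n = sum_j (j+1) t_j and exchange the sums. Without the test [j < n],
    truncated subtraction would turn terms of negative index into h_0. *)
Lemma poisson_order_h_rec n l :
  n%:R * poisson_order_h k n l =
  \sum_(j < k)
    if (j < n)%N then l * j.+1%:R * poisson_order_h k (n - j.+1) l else 0.
Proof.
transitivity (\sum_(j < k) j.+1%:R *
    (if (j < n)%N then l * poisson_order_h k (n - j.+1) l else 0)).
  under [RHS]eq_bigr do rewrite -poisson_order_h_moment mulr_sumr.
  rewrite exchange_big /= mulr_sumr; apply: eq_bigr => t /eqP tn.
  rewrite -[X in X%:R]tn natr_sum mulr_suml; apply: eq_bigr => j _.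
  by rewrite natrM -mulrA.
by apply: eq_bigr => j _; case: ifP => _; rewrite ?mulr0 // mulrCA mulrA.
Qed.

(** * Monotonicity in l and bounds in n *)

Lemma le_poisson_order_h n l l' :
  0 <= l -> l <= l' -> poisson_order_h k n l <= poisson_order_h k n l'.
Proof.
move=> l0 ll'; apply: ler_sum => t _; apply: ler_wpM2r.
  by rewrite invr_ge0; apply: prodr_ge0 => i _; exact: ler0n.
by rewrite lerXn2r // nnegrE (le_trans l0).
Qed.

Lemma poisson_order_h_rec_ge n l (j : 'I_k) : 0 <= l -> (j < n)%N ->
  l * j.+1%:R * poisson_order_h k (n - j.+1) l <= n%:R * poisson_order_h k n l.
Proof.
move=> l0 jn; rewrite poisson_order_h_rec (bigD1 j) //= jn lerDl sumr_ge0 // => i _.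
by case: ifP => // _; rewrite !mulr_ge0 // poisson_order_h_ge0.
Qed.

(** [kappa] is the sum of the weights 1, ..., k of the recurrence; [0 <= B] covers the terms that
    vanish when n < k. *)
Lemma poisson_order_h_rec_le n l B : 0 <= l -> 0 <= B ->
  (forall m, (m < n)%N -> poisson_order_h k m l <= B) ->
  n%:R * poisson_order_h k n l <= l * kappa R k * B.
Proof.
move=> l0 B0 hB.
have -> : kappa R k = \sum_(j < k) j.+1%:R.
  rewrite /kappa; elim: k => [|m IH]; first by rewrite big_ord0 mul0r mul0r.
  by rewrite big_ord_recr /= -IH -natr1; field.
rewrite poisson_order_h_rec mulr_sumr mulr_suml; apply: ler_sum => j _.
case: ifP => jn; last by rewrite !mulr_ge0.
by apply: ler_wpM2l; rewrite ?mulr_ge0 // hB // ltn_subrL /= (leq_trans _ jn).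
Qed.

Lemma poisson_order_h_gt0 n l : (0 < k)%N -> 0 < l -> 0 < poisson_order_h k n l.
Proof.
move=> k0 l0; elim: n => [|n IH]; first by rewrite poisson_order_h0.
rewrite -(pmulr_rgt0 _ (ltr0Sn R n)).
apply: lt_le_trans (@poisson_order_h_rec_ge n.+1 l (Ordinal k0) (ltW l0) _) => //=.
by rewrite subSS subn0 !mulr_gt0.
Qed.

Lemma lt_poisson_order_h n l l' : (0 < k)%N -> (0 < n)%N ->
  0 <= l -> l < l' -> poisson_order_h k n l < poisson_order_h k n l'.
Proof.
case: n => // n k0 _ l0 ll'; have l'0 := le_lt_trans l0 ll'.
rewrite -(ltr_pM2l (ltr0Sn R n)) !poisson_order_h_rec !(bigD1 (P:=predT) (Ordinal k0)) //=.
(* Strictness comes from the first term: l h_n(l) <= l h_n(l') < l' h_n(l'), even for l = 0. *)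
rewrite !mulr1 subSS subn0; apply: ltr_leD.
  apply: le_lt_trans (_ : l * poisson_order_h k n l' < _).
    by rewrite ler_wpM2l // le_poisson_order_h // ltW.
  by rewrite ltr_pM2r // poisson_order_h_gt0.
apply: ler_sum => i _; case: ifP => // _.
apply: ler_pM; rewrite ?mulr_ge0 ?poisson_order_h_ge0 //.
  by rewrite ler_wpM2r // ltW.
by rewrite le_poisson_order_h // ltW.
Qed.

Lemma continuous_poisson_order_h n : continuous (@poisson_order_h R k n).
Proof.
move=> l; rewrite /poisson_order_h; apply: cvg_big => [|t _]; first exact: add_continuous.
by apply: cvgMl; exact: exprn_continuous.
Qed.

(** Here l kappa = 1, so strong induction with B = 1 gives (n+1) h_(n+1) <= 1 <= n+1. *)
Lemma poisson_order_h_kappa n : (0 < k)%N -> poisson_order_h k n (1 / kappa R k) <= 1.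
Proof.
move=> k0.
have kap0 : 0 < kappa R k by rewrite /kappa divr_gt0 // mulr_gt0 ?addr_gt0 // ltr0n.
elim/ltn_ind: n => -[|n] IH; first by rewrite poisson_order_h0.
have := @poisson_order_h_rec_le n.+1 (1 / kappa R k) 1 _ ler01 IH.
rewrite divfK ?gt_eqF // mulr1 => /(_ (divr_ge0 ler01 (ltW kap0))) h.
rewrite -(ler_pM2l (ltr0Sn R n)) mulr1 (le_trans h) //.
by rewrite ler1n.
Qed.

(** By monotonicity l = L is the worst case; there a bound B on all h_n improves to L kappa B /
    n. *)
Lemma poisson_order_h_eventually_lt1 L : 0 <= L ->
  exists N, forall n l, (N <= n)%N -> 0 <= l -> l <= L -> poisson_order_h k n l < 1.
Proof.
move=> L0; have kap0 : 0 <= kappa R k by rewrite /kappa !mulr_ge0 // addr_ge0.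
(* From index [K] on, L kappa / n < 1, so the recurrence preserves any nonnegative bound on the
   earlier values. *)
pose K := Num.bound (L * kappa R k).
have LK n : (K <= n)%N -> L * kappa R k < n%:R.
  by move=> Kn; rewrite (lt_le_trans (archi_boundP _)) ?mulr_ge0 // ler_nat.
(* By nonnegativity this sum dominates each of the first [K] values. *)
pose B := \sum_(i < K) poisson_order_h k i L.
have B0 : 0 <= B by apply: sumr_ge0 => i _; exact: poisson_order_h_ge0.
have hB n : poisson_order_h k n L <= B.
  elim/ltn_ind: n => n IH; case: (ltnP n K) => nK.
    rewrite /B (bigD1 (Ordinal nK)) //= lerDl sumr_ge0 // => i _.
    exact: poisson_order_h_ge0.
  have n0 : 0 < n%:R :> R by rewrite (le_lt_trans _ (LK _ nK)) // mulr_ge0.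
  rewrite -(ler_pM2l n0) (le_trans (@poisson_order_h_rec_le n L B _ _ _)) //.
  by rewrite ler_wpM2r // ltW // LK.
exists (Num.bound (L * kappa R k * B)) => n l Nn l0 lL.
rewrite (le_lt_trans (@le_poisson_order_h n l L _ _)) //.
have nB : L * kappa R k * B < n%:R.
  by rewrite (lt_le_trans (archi_boundP _)) ?mulr_ge0 // ler_nat.
have n0 : 0 < n%:R :> R by rewrite (le_lt_trans _ nB) // !mulr_ge0.
by rewrite -(ltr_pM2l n0) mulr1 (le_lt_trans (@poisson_order_h_rec_le n L B _ _ _)).
Qed.

(** * Double modes and the root r_k *)

Lemma is_mode0P l : is_mode k l 0 <-> forall n, poisson_order_h k n l <= 1.
Proof.
rewrite /is_mode /poisson_order_pmf poisson_order_h0.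
by split=> + n => /(_ n); rewrite ler_pM2l // expR_gt0.
Qed.

Lemma double_mode_at_0P l : double_mode_at_0 k l <->
  [/\ 0 < l, forall n, poisson_order_h k n l <= 1
    & exists2 m, (0 < m)%N & poisson_order_h k m l = 1].
Proof.
have e0 := expR_gt0 (- (k%:R * l)).
split=> [[l0 [m [m0 /is_mode0P h1 hm]]]|[l0 h1 [m m0 hm]]]; split=> //.
  exists m => //; apply/le_anti; rewrite h1 /=.
  by move: (hm 0%N); rewrite /poisson_order_pmf poisson_order_h0 ler_pM2l.
exists m; split=> // [|n]; first exact/is_mode0P.
by rewrite /poisson_order_pmf hm ler_pM2l.
Qed.

(** Existence comes from the intermediate value theorem on [0, 1], uniqueness from strict
    monotonicity; [root_r] takes its default 0 unless both hold. *)
Lemma root_rP : (0 < k)%N -> 0 < root_r R k /\ poisson_order_h k k (root_r R k) = 1.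
Proof.
move=> k0.
(* At l = 1 the last term of the recurrence is k h_0 = k. *)
have k1 : 1 <= poisson_order_h k k (1 : R).
  have kk : (k.-1 < k)%N by rewrite prednK.
  rewrite -(@ler_pM2l _ k%:R) ?ltr0n // mulr1.
  have := @poisson_order_h_rec_ge k 1 (Ordinal kk) ler01 kk.
  by rewrite /= prednK // subnn poisson_order_h0 mul1r mulr1.
have h0 : poisson_order_h k k (0 : R) = 0.
  apply/eqP; rewrite -(mulrI_eq0 _ (@mulfI _ k%:R _)) ?pnatr_eq0 -?lt0n //.
  by rewrite poisson_order_h_rec big1 // => j _; case: ifP; rewrite // !mul0r.
have [|r /itvP rI hr] := @IVT R (poisson_order_h k k) 0 1 1 ler01
  (continuous_subspaceT (@continuous_poisson_order_h k)).
  by rewrite h0 min_l ?ler01 ?(le_trans ler01 k1) // max_r // (le_trans ler01 k1).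
have r0 : 0 < r.
  rewrite lt_neqAle rI andbT.
  by apply: contra_eqN hr => /eqP <-; rewrite h0 eq_sym oner_eq0.
have uniq_r : unique (fun l : R => 0 < l /\ poisson_order_h k k l = 1) r.
  split=> // l [l0 hl]; apply/eqP; case: ltgtP => // lt; exfalso;
   [have := @lt_poisson_order_h k r l k0 k0 (ltW r0) lt
   |have := @lt_poisson_order_h k l r k0 k0 (ltW l0) lt];
   by rewrite hl hr ltxx.
by rewrite /root_r (@xget_unique _ 0 _ r) // => y [? yu]; apply: yu; case: uniq_r.
Qed.

End PoissonOrderH.

(** * The first double mode as a supremum *)

Theorem proposition4p2 (R : realType) (k : nat) (hk : (2 <= k)%N) :
  hat_lambda R k \in `[1 / kappa R k, root_r R k].
Proof.
have k0 : (0 < k)%N by exact: ltnW.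
have [r0 hr] := @root_rP R k k0.
have kap0 : 0 < 1 / kappa R k.
  by rewrite /kappa !divr_gt0 // mulr_gt0 ?addr_gt0 // ltr0n.
(* Admitting l = 0 makes [A] closed; positivity of its supremum is recovered from 1/kappa. *)
pose A : set R := [set l | 0 <= l /\ forall n, poisson_order_h k n l <= 1]%classic.
have Ar l : A l -> l <= root_r R k.
  move=> [l0 hl]; rewrite leNgt; apply/negP => /(lt_poisson_order_h k0 k0 (ltW r0)).
  by rewrite hr ltNge hl.
have Akap : A (1 / kappa R k).
  by split; [exact: ltW|move=> n; exact: poisson_order_h_kappa].
have ubA : has_ubound A by exists (root_r R k).
have clA : closed A.
  have -> : A = ([set l | 0 <= l] `&`
      \bigcap_(n in [set: nat]) (poisson_order_h k n @^-1` [set y | y <= 1]))%classic.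
    by apply/seteqP; split=> l [l0 hl]; split=> // n; [move=> _|]; exact: hl.
  apply: closedI; first exact: closed_ge.
  apply: closed_bigI => n _; apply: preimage_closed; last exact: closed_le.
  by move=> ? _; exact: continuous_poisson_order_h.
pose c := sup A.
have [c0 hc] : A c by apply: clA; apply: closure_sup => //; exists (1 / kappa R k).
have kapc : 1 / kappa R k <= c by exact: ub_le_sup.
have cgt0 : 0 < c := lt_le_trans kap0 kapc.
have dc : double_mode_at_0 k c.
  apply/double_mode_at_0P; split=> //; apply: contrapT => no.
  (* The bound c + 1 leaves room to the right of c. *)
  have [N hN] := @poisson_order_h_eventually_lt1 R k (c + 1) (addr_ge0 c0 ler01).
  have lt1 n : (0 < n)%N -> poisson_order_h k n c < 1.
    move=> n0; rewrite lt_neqAle hc andbT; apply/eqP => hn.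
    by apply: no; exists n.
  (* The shift [i.+1] skips h_0 = 1, which is never below 1. *)
  have : \forall x \near c, forall i : 'I_N, poisson_order_h k i.+1 x < 1.
    apply: (filter_forall (nbhs_filter c)) => i.
    by apply: (cvgr_lt (poisson_order_h k i.+1 c));
      [exact: continuous_poisson_order_h|exact: lt1].
  move=> /nbhs_ballP[e /= e0 he].
  (* e/2 keeps x in the ball, where the first indices are controlled; 1 keeps x <= c + 1, where [hN]
     controls the rest. *)
  pose x := c + Num.min (e / 2) 1.
  have m0 : 0 < Num.min (e / 2) 1 by rewrite lt_min ltr01 divr_gt0.
  have cx : c < x by rewrite ltrDl.
  have : A x.
    split=> [|[|n]]; first by rewrite ltW // (lt_trans cgt0).
      by rewrite poisson_order_h0.
    case: (ltnP n N) => nN; apply: ltW.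
      suff /he/(_ (Ordinal nN)) : ball c e x by [].
      rewrite /ball /= /x opprD addNKr normrN gtr0_norm //.
      by rewrite gt_min ltr_pdivrMr // mulr_natr mulr2n ltrDl e0.
    apply: hN => //; first exact: leqW.
      by rewrite ltW // (lt_trans cgt0).
    by rewrite lerD2l ge_min lexx orbT.
  by move=> /(ub_le_sup ubA); rewrite leNgt cx.
have lbc : lbound (double_mode_at_0 k) c.
  move=> l /double_mode_at_0P[l0 hl [m m0 hm]]; rewrite leNgt; apply/negP => lc.
  by have := lt_poisson_order_h k0 m0 (ltW l0) lc; rewrite hm ltNge hc.
(* A least element is unique, so [xget] returns c and not its default. *)
rewrite /hat_lambda (@xget_unique _ 0 _ c) //.
  by rewrite in_itv /= kapc Ar.
by move=> y [dy lby]; apply/le_anti; rewrite lby // lbc.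
Qed.
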